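(* Let $\mathcal{X}$ be a stochastic, irreducible and aperiodic homogeneous discrete-time Markov chain on a countably infinite state space $S$ with $n$-step transition probabilities $P^{(n)}(i,j)$, $i,j\in S$, and suppose $\mathcal{X}$ is simple. If, for some positive integer $n$, there exists a constant $\delta>0$ such that $P^{(n)}(i,i)\ge\delta$ for all but finitely many states $i\in S$, while $\mathcal{X}^{(n)}$ is simple, then $\mathcal{X}$ is asymptotically aperiodic.
   Context: $\mathcal{X}=\{X(n),\,n=0,1,\dots\}$ has an arbitrary initial distribution, and $\mathbb{P}$ is the induced probability measure on sample paths. For $m\ge 1$, $\mathcal{X}^{(m)}=\{X^{(m)}(n)=X(nm),\ n=0,1,\dots\}$ is the $m$-step chain. For a Markov chain $\mathcal{Y}=\{Y(n)\}$ on $S$ (here $\mathcal{X}$ or some $\mathcal{X}^{(m)}$) and $C\subset S$ let $U(C)=\{Y(n)\in C \text{ for infinitely many } n\}$ and $L(C)=\{Y(n)\in C\text{ for all sufficiently large }n\}$. $C$ is transient (w.r.t. $\mathcal{Y}$) if $\mathbb{P}(U(C))=0$; regular if $\mathbb{P}(U(C)\setminus L(C))=0$; almost closed if it is regular and not transient. These notions do not depend on the initial distribution. An almost closed set is atomic if it does not contain two disjoint almost closed subsets, and nonatomic otherwise. Two regular sets are equivalent if their symmetric difference is transient. A Blackwell decomposition of $S$ for $\mathcal{Y}$ is a finite or countable collection $\{C_1,C_2,\dots\}$ of disjoint almost closed sets such that (i) every $C_i$, except at most one, is atomic; (ii) the nonatomic $C_i$, if present, contains no atomic subsets and consists of transient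 states; (iii) $\sum_i\mathbb{P}(L(C_i))=1$. By a theorem of Blackwell such a decomposition exists and is unique up to equivalence; $\beta(\mathcal{Y})$ denotes the number of sets in it. $\mathcal{Y}$ is simple if $\beta(\mathcal{Y})=1$. The asymptotic period of a simple chain $\mathcal{X}$ is $d(\mathcal{X}):=\sup\{m\ge1 : \beta(\mathcal{X}^{(m)})=m\}\in\{1,2,\dots\}\cup\{\infty\}$; $\mathcal{X}$ is asymptotically aperiodic if $d(\mathcal{X})=1$. *)

(* Defs.v *)
From HB Require Import structures.
From mathcomp Require Import all_boot all_order all_algebra.
From mathcomp Require Import all_classical all_reals all_analysis.

Set Implicit Arguments.
Unset Strict Implicit.
Unset Printing Implicit Defensive.

Import Order.TTheory GRing.Theory Num.Theory.

Local Open Scope classical_set_scope.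
Local Open Scope ring_scope.
Local Open Scope ereal_scope.

Section transition_matrix.
Context {R : realType} {S : countType}.
Implicit Types (P : S -> S -> R) (i j : S).

Definition stochastic P : Prop :=
  (forall i j, (0 <= P i j)%R) /\
  (forall i, \esum_(j in [set: S]) (P i j)%:E = 1).

(* The entries are nonnegative, so the infinite row-by-column sums always exist
   in \bar R; they are finite when P is stochastic. *)
Fixpoint nstep P (n : nat) i j : \bar R :=
  match n with
  | 0%N => if i == j then 1 else 0
  | m.+1 => \esum_(k in [set: S]) ((P i k)%:E * nstep P m k j)
  end.

Definition irreducible P : Prop := forall i j, exists n, 0 < nstep P n i j.

Definition is_period P i (p : nat) : Prop :=
  let return_times := [set n : nat | (0 < n)%N /\ 0 < nstep P n i i] in
  (forall n, return_times n -> (p %| n)%N) /\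
  (forall q, (forall n, return_times n -> (q %| n)%N) -> (q %| p)%N).

Definition aperiodic P : Prop := forall i, is_period P i 1.

End transition_matrix.

Section chains.
Context {R : realType} {S : countType} {d : measure_display}
  {Omega : measurableType d}.
Variable Pr : probability Omega R.
Implicit Types (X Y : nat -> Omega -> S) (C : set S) (D : set (set S)).

Definition initial_path X (s : nat -> S) (n : nat) : set Omega :=
  [set w | forall k, (k <= n)%N -> X k w = s k].

(* The last clause is
     Pr (X n.+1 = s n.+1 | X 0 = s 0, ..., X n = s n) = P (s n) (s n.+1)
   multiplied by the probability of the conditioning event; the law of X 0 is
   unconstrained. *)
Definition markov_chain (P : S -> S -> R) X : Prop :=
  (forall n i, measurable [set w | X n w = i]) /\
  (forall (s : nat -> S) n,
     Pr (initial_path X s n.+1) =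
     Pr (initial_path X s n) * (P (s n) (s n.+1))%:E).

Definition mstep_chain X (m : nat) : nat -> Omega -> S := fun n => X (n * m)%N.

Definition infinitely_often Y C : set Omega :=
  lim_sup_set (fun n => [set w | C (Y n w)]).

Definition eventually_in Y C : set Omega :=
  [set w | \forall n \near \oo, C (Y n w)].

Definition transient Y C : Prop := Pr (infinitely_often Y C) = 0.

Definition regular Y C : Prop :=
  Pr (infinitely_often Y C `\` eventually_in Y C) = 0.

Definition almost_closed Y C : Prop := regular Y C /\ ~ transient Y C.

Definition splits Y C : Prop :=
  exists A B : set S, [/\ A `<=` C, B `<=` C, A `&` B = set0,
    almost_closed Y A & almost_closed Y B].

Definition atomic Y C : Prop := almost_closed Y C /\ ~ splits Y C.

Definition nonatomic Y C : Prop := almost_closed Y C /\ splits Y C.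

(* Almost closed sets are nonempty, so a finite or countable collection of
   disjoint almost closed sets is a countable set of sets, without repetition. *)
Definition blackwell_decomposition Y D : Prop :=
  [/\ countable D /\ trivIset D id,
      forall C, D C -> almost_closed Y C,
      forall C C', D C -> D C' -> ~ atomic Y C -> ~ atomic Y C' -> C = C',
      forall C, D C -> nonatomic Y C ->
        (forall A, A `<=` C -> ~ atomic Y A) /\
        (forall i, C i -> transient Y [set i]) &
      \esum_(C in D) Pr (eventually_in Y C) = 1].

(* A Blackwell decomposition exists and is unique up to equivalence for every
   chain considered, so the number of its sets does not depend on the one
   picked; the default set0 would give the value 0, which is the size of no
   decomposition. *)
Definition beta Y : \bar R :=
  counting (xget set0 [set D | blackwell_decomposition Y D]).

Definition simple Y : Prop := beta Y = 1.

Definition asymptotic_period X : \bar R :=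
  ereal_sup [set m%:R%:E | m in
    [set m : nat | (0 < m)%N /\ beta (mstep_chain X m) = m%:R%:E]].

Definition asymptotically_aperiodic X : Prop := asymptotic_period X = 1.

End chains.

(* Main.v *)
(* For A almost closed for X^(m), the set of the states from which A is entered
   in one step with probability at least 1/2 is A shifted by one time unit, and
   the union of the m iterated shifts of A is regular for X itself. Suppose
   beta(X^(m)) = m >= 2. One of the m sets of the decomposition is atomic, so
   the simple chain X is atomic, as two disjoint parts of an X-regular set would
   split that atom. Then for each of the m disjoint sets there is almost surely
   a residue r such that X is eventually in the set at the times congruent to r
   mod m, and by the pigeonhole principle there is only one. A probability of
   return in n steps that is bounded below makes r and r + n agree mod m, so m
   divides n; a visit to the finitely many exceptional states is excluded in the
   same way, with a return time that m does not divide. Hence two disjoint sets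
   are almost closed for X^(n), which is therefore nonatomic without atomic
   subsets. This contradicts the atomicity of X, under which X^(n) has at most n
   disjoint almost closed sets. *)

Require Import Defs.
From HB Require Import structures.
From mathcomp Require Import all_boot all_order all_algebra.
From mathcomp Require Import finmap.
From mathcomp Require Import all_classical all_reals all_analysis.

Set Implicit Arguments.
Unset Strict Implicit.
Unset Printing Implicit Defensive.

Import Order.TTheory GRing.Theory Num.Theory.

Local Open Scope classical_set_scope.
Local Open Scope ring_scope.
Local Open Scope ereal_scope.

(** * Sums over countable types and countable partitions of events *)

Section countable_sums.
Context {R : realType} {T : countType}.
Implicit Types f : T -> \bar R.

(** [pickle] injects the type into the integers, and integers outside its range contribute 0. This
    gives access to the theory of series, in particular to countable additivity. *)
Lemma esum_nneseries f : (forall i, 0 <= f i) ->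
  \esum_(i in [set: T]) f i =
  \sum_(0 <= n <oo) oapp f 0 (pickle_inv n : option T).
Proof.
move=> f0; rewrite nneseries_esumT; last by move=> n; case: pickle_inv.
rewrite (esumID (range (@choice.pickle T))); last first.
  by move=> n _; case: pickle_inv.
rewrite [X in _ = _ + X]esum1 ?adde0; last first.
  move=> n [_ /= nT]; case E : pickle_inv => [i|//].
  by case: nT; exists i => //; have := @choice.pickle_invK T n; rewrite E.
rewrite setTI (reindex_esum [set: T] (range (@choice.pickle T)) choice.pickle).
  by apply: eq_esum => i _; rewrite pickleK_inv.
split; [by move=> i _; exists i| |by move=> _ [i _ <-]; exists i].
by move=> i j _ _; apply: (pcan_inj (@choice.pickleK T)).
Qed.

Lemma esumZl (c : R) f : (0 <= c)%R -> (forall i, 0 <= f i) ->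
  \esum_(i in [set: T]) (c%:E * f i) = c%:E * \esum_(i in [set: T]) f i.
Proof.
move=> c0 f0; rewrite !esum_nneseries//; last by move=> i; rewrite mule_ge0.
rewrite -nneseriesZl; last by move=> n _; case: pickle_inv.
by apply: eq_eseriesr => n _; case: pickle_inv => //=; rewrite mule0.
Qed.

Lemma measure_partition d (U : measurableType d)
    (mu : {measure set U -> \bar R}) (f : U -> T) (B : set U) :
  (forall i, measurable [set x | f x = i]) -> measurable B ->
  mu B = \esum_(i in [set: T]) mu (B `&` [set x | f x = i]).
Proof.
move=> mf mB; rewrite esum_nneseries//.
pose F n := B `&` [set x | Some (f x) = pickle_inv n].
have mF n : measurable (F n).
  apply: measurableI => //; case: (pickle_inv n) => [i|].
    rewrite (_ : [set x | _] = [set x | f x = i])//.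
    by apply/seteqP; split => x /= => [[]|->].
  by rewrite (_ : [set x | _] = set0)//; apply/seteqP; split.
have -> : B = \bigcup_n F n.
  apply/seteqP; split => [x Bx|x [n _ []]//].
  by exists (choice.pickle (f x)) => //; split => //=; rewrite pickleK_inv.
rewrite measure_bigcup//; last first.
  apply/trivIsetP => n m _ _;
    apply: contraNeq => /set0P[x [[_ /= xn] [_ /= xm]]].
  apply/eqP; have := @choice.pickle_invK T n; have := @pickle_invK T m.
  by rewrite -xn -xm /= => -> ->.
under eq_eseriesl do rewrite in_setT.
apply: eq_eseriesr => n _; case E : (pickle_inv n) => [i|] /=.
  congr (mu _); apply/seteqP; split => x /=.
    by move=> Fx; split; [exists n|case: Fx => _ /=; rewrite E => -[]].
  by move=> [[k _ [Bx _]] fi]; split => //=; rewrite fi E.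
by rewrite (_ : F n = set0) ?measure0//; apply/seteqP; split => x //= [_ /=];
  rewrite E.
Qed.

End countable_sums.

Lemma nstep_ge0 (R : realType) (S : countType) (P : S -> S -> R) n i j :
  stochastic P -> 0 <= nstep P n i j.
Proof.
case=> P0 _; elim: n i j => [|n IH] i j /=; first by case: eqP.
by apply: esum_ge0 => k _; rewrite mule_ge0 ?lee_fin.
Qed.

(** * Residues met by an additive set of integers *)

(** The residues of [T] mod [m] are closed under addition. The least positive [g] whose residue is
    met divides every element of [T], so [g] = 1, and the multiples of 1 are all the residues. *)
Lemma residues_of_return_times (T : nat -> Prop) m : (0 < m)%N ->
  T 0%N -> (forall a b, T a -> T b -> T (a + b)%N) ->
  (forall q, (forall a, T a -> q %| a)%N -> (q %| 1)%N) ->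
  forall x, exists2 a, T a & a = x %[mod m].
Proof.
move=> m0 T0 TD Tgcd; pose H x := exists2 a, T a & a = x %[mod m].
have HD x y : H x -> H y -> H (x + y)%N.
  move=> [a Ta ax] [b Tb by_]; exists (a + b)%N; first exact: TD.
  by rewrite -modnDm ax by_ modnDm.
have HM k x : H x -> H (k * x)%N.
  by move=> Hx; elim: k => [|k IH]; [exists 0%N|rewrite mulSn; exact: HD].
have Hm : exists g, (0 < g)%N && `[< H g >].
  by exists m; rewrite m0; apply/asboolP; exists 0%N; rewrite // modnn mod0n.
case: (ex_minnP Hm) => g /andP[g0 /asboolP Hg] gmin.
suff /Tgcd : forall a, T a -> (g %| a)%N.
  rewrite dvdn1 => /eqP g1 x; rewrite -(muln1 x) -g1; exact: HM.
move=> a Ta; rewrite /dvdn; apply/negPn/negP; rewrite -lt0n => r0.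
(* Adding [m.-1] copies of a multiple of [g] subtracts it mod [m], so the remainder of [a] by [g]
   has a residue met by [T], against the minimality of [g]. *)
have /gmin : (0 < a %% g)%N && `[< H (a %% g)%N >].
  rewrite r0; apply/asboolP.
  have [b Tb bE] : H (a + m.-1 * (a %/ g * g))%N.
    by apply: HD; [exists a|exact: HM (HM _ _ Hg)].
  exists b => //; rewrite bE {1}(divn_eq a g) addnAC -mulSn prednK//.
  by rewrite (mulnC m) modnMDl.
by rewrite leqNgt ltn_mod g0.
Qed.

Lemma near_mulnD m (Q : nat -> Prop) :
  (\forall k \near \oo, Q (k * m)%N) <->
  \forall k \near \oo, Q (m + k * m)%N.
Proof.
split=> [] [N _ NQ].
  by exists N => // k Nk; rewrite -mulSn; apply: NQ; exact: leqW.
exists N.+1 => // -[//|k] Nk; rewrite mulSn; exact: NQ.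
Qed.

(** * Events of path space *)

Section path_events.
Context {S : Type}.

(** This is the pi-system for the lambda-system argument in [future_proportional]. No measurability
    is required of the set: over a countable [S] it is a countable union of cylinders. *)
Definition finite_horizon : set (set (nat -> S)) :=
  [set E | exists N, forall p p',
    (forall k, (k <= N)%N -> p k = p' k) -> E p -> E p'].

Lemma finite_horizonI : setI_closed finite_horizon.
Proof.
move=> E F [N hE] [M hF]; exists (maxn N M) => p p' pp' [Ep Fp]; split.
  by apply: hE Ep => k kN; apply: pp'; rewrite leq_max kN.
by apply: hF Fp => k kM; apply: pp'; rewrite leq_max kM orbT.
Qed.

Definition path_event : set (set (nat -> S)) := <<s finite_horizon >>.

Lemma path_event_at k (A : set S) : path_event [set p | A (p k)].
Proof.
by apply: sub_sigma_algebra; exists k => p p' pp' /=; rewrite pp'.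
Qed.

Lemma path_eventC E : path_event E -> path_event (~` E).
Proof. by move=> hE; rewrite -setTD; exact: sigma_algebraCD. Qed.

Lemma path_event_bigcup (F : nat -> set (nat -> S)) :
  (forall k, path_event (F k)) -> path_event (\bigcup_k F k).
Proof. exact: sigma_algebra_bigcup. Qed.

Lemma path_eventU E F : path_event E -> path_event F -> path_event (E `|` F).
Proof.
move=> hE hF; rewrite -bigcup2E; apply: path_event_bigcup => -[|[|k]] //=.
exact: sigma_algebra0.
Qed.

Lemma path_event_near (I : nat -> nat) (A : set S) :
  path_event [set p | \forall k \near \oo, A (p (I k))].
Proof.
rewrite (_ : [set p | _] =
  \bigcup_N ~` \bigcup_k ~` [set p : nat -> S | A (p (I (N + k)%N))]).
  apply: path_event_bigcup => N; apply: path_eventC.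
  by apply: path_event_bigcup => k; apply: path_eventC; exact: path_event_at.
apply/seteqP; split => p /=.
  move=> [N _ NA]; exists N => //= -[k _]; apply; apply: NA => /=;
    exact: leq_addr.
move=> [N _ NA]; exists N => // k /= Nk; apply: contrapT => nA.
by apply: NA; exists (k - N)%N => //=; rewrite subnKC.
Qed.

End path_events.

Lemma counting_gt1 (T : choiceType) (R : realType) (D : set T) m : (1 < m)%N ->
  counting D = m%:R%:E :> \bar R -> exists A B, [/\ D A, D B & A <> B].
Proof.
move=> m1; rewrite /counting; case: asboolP => // fD [] /eqP.
rewrite eqr_nat => /eqP cD.
have s0 : (0 < size (fset_set D))%N by rewrite cD ltnW.
have s1 : (1 < size (fset_set D))%N by rewrite cD.
have [x0 _] : exists x, x \in fset_set D.
  by apply/fset0Pn; rewrite -cardfs_gt0.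
pose a k := nth x0 (fset_set D) k.
have aD k : (k < size (fset_set D))%N -> D (a k).
  by move=> /(mem_nth x0); rewrite in_fset_set// inE.
exists (a 0%N), (a 1%N); split; [exact: aD|exact: aD|].
by move=> /eqP; rewrite nth_uniq ?fset_uniq.
Qed.

Lemma mstep_chain1 (S : countType) d (Omega : measurableType d)
  (X : nat -> Omega -> S) : mstep_chain X 1 = X.
Proof. by apply/funext => k; rewrite /mstep_chain muln1. Qed.

(** * Events known at a given time and the Markov property *)

Section chain.
Context {R : realType} {S : countType} {d : measure_display}
  {Omega : measurableType d}.
Context (Pr : probability Omega R) (P : S -> S -> R) (X : nat -> Omega -> S).
Context (Pstoch : stochastic P) (Xchain : markov_chain Pr P X).
Context (Paper : aperiodic P).
Implicit Types (m n r s t : nat) (w : Omega).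

(** These are the events of the natural filtration, encoded by invariance. Paths up to time [t] form
    a countable type, so that measurability is automatic: see [measurable_known_at]. *)
Definition known_at (t : nat) : set (set Omega) :=
  [set B | forall w w',
    (forall k, (k <= t)%N -> X k w = X k w') -> B w -> B w'].

Definition path_upto t w : t.+1.-tuple S := [tuple X k w | k < t.+1].

Lemma known_at_le t t' B : (t <= t')%N -> known_at t B -> known_at t' B.
Proof.
by move=> tt' kB w w' ww'; apply: kB => k kt; apply: ww'; apply: leq_trans tt'.
Qed.

Lemma known_atI t B C : known_at t B -> known_at t C -> known_at t (B `&` C).
Proof. by move=> kB kC w w' ww' [/(kB _ _ ww') ? /(kC _ _ ww')]. Qed.

Lemma known_atC t B : known_at t B -> known_at t (~` B).
Proof. by move=> kB w w' ww' nB Bw'; apply: nB; apply: kB Bw' => k /ww'. Qed.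

Lemma known_atU t B C : known_at t B -> known_at t C -> known_at t (B `|` C).
Proof.
by move=> kB kC w w' ww' [/(kB _ _ ww')|/(kC _ _ ww')]; [left|right].
Qed.

Lemma known_at_bigcap (I : Type) (D : set I) t (F : I -> set Omega) :
  (forall i, D i -> known_at t (F i)) -> known_at t (\bigcap_(i in D) F i).
Proof. by move=> kF w w' ww' Fw i Di; apply: (kF i Di _ _ ww'); apply: Fw. Qed.

Lemma known_at_preimage t k (A : set S) :
  (k <= t)%N -> known_at t [set w | A (X k w)].
Proof. by move=> kt w w' ww' /=; rewrite ww'. Qed.

Let mX k i : measurable [set w | X k w = i].
Proof. by case: Xchain. Qed.

Lemma measurable_initial_path (s : nat -> S) t :
  measurable (initial_path X s t).
Proof.
rewrite (_ : initial_path _ _ _ = \bigcap_(k in `I_t.+1) [set w | X k w = s k]).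
  by apply: bigcap_measurable => //; exists 0%N.
by apply/seteqP; split => w h k; apply: h.
Qed.

Lemma path_uptoE t (c : t.+1.-tuple S) (s : nat -> S) :
  (forall k : 'I_t.+1, s k = tnth c k) ->
  [set w | path_upto t w = c] = initial_path X s t.
Proof.
move=> sc; apply/seteqP; split => w /=.
  by move=> cw k kt; have /= -> := sc (Ordinal (kt : (k < t.+1)%N));
    rewrite -cw tnth_mktuple.
move=> h; apply: eq_from_tnth => k; rewrite tnth_mktuple -sc h//.
by rewrite -ltnS.
Qed.

Lemma measurable_path_upto t (c : t.+1.-tuple S) :
  measurable [set w | path_upto t w = c].
Proof.
rewrite (@path_uptoE t c (fun k => tnth c (inord k))).
  exact: measurable_initial_path.
by move=> k; rewrite inord_val.
Qed.

Lemma known_at_path t B (c : t.+1.-tuple S) : known_at t B ->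
  B `&` [set w | path_upto t w = c] = set0 \/
  B `&` [set w | path_upto t w = c] = [set w | path_upto t w = c].
Proof.
move=> kB; have [->|/eqP/set0P[w [Bw cw]]] :=
  pselect (B `&` [set w | path_upto t w = c] = set0); first by left.
right; apply/seteqP; split => [w' []//|w' cw']; split => //;
  apply: kB Bw => k kt.
have /= cE v : path_upto t v = c -> X k v = tnth c (inord k).
  by move<-; rewrite tnth_mktuple inordK.
by rewrite !cE.
Qed.

Lemma measurable_known_at t B : known_at t B -> measurable B.
Proof.
move=> kB.
have -> : B = \bigcup_(c in [set: t.+1.-tuple S])
    (B `&` [set w | path_upto t w = c]).
  by apply/seteqP; split => [w Bw|w [c _ []]//]; exists (path_upto t w).
apply: countable_bigcupT_measurable => [|c]; first exact: countableP.
case: (known_at_path c kB) => -> //; exact: measurable_path_upto.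
Qed.

(** Split along the countably many paths up to time [t]: each is either incompatible with the event
    [B] and X t = i or contained in it, and in the second case the defining equation of
    [markov_chain] applies. *)
Lemma markov_step t B i j : known_at t B ->
  Pr (B `&` [set w | X t w = i] `&` [set w | X t.+1 w = j]) =
  Pr (B `&` [set w | X t w = i]) * (P i j)%:E.
Proof.
move=> kB; have kBi : known_at t (B `&` [set w | X t w = i]).
  by apply: known_atI => //; exact: (@known_at_preimage t t [set i]).
have mBi := measurable_known_at kBi.
have mpath := @measurable_path_upto t.
rewrite (measure_partition Pr mpath (measurableI _ _ mBi (mX t.+1 j))).
rewrite (measure_partition Pr mpath mBi) muleC.
rewrite -esumZl//; last by case: Pstoch.
apply: eq_esum => c _; rewrite (setIAC (B `&` _)).
have [->|/eqP/set0P[w [[Bw Xtw] cw]]] :=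
    pselect (B `&` [set w | X t w = i] `&` [set w | path_upto t w = c] = set0).
  by rewrite set0I measure0 mule0.
have [E|->] := known_at_path c kBi.
  by move/seteqP : E => [/(_ w) E _]; exfalso; apply: E.
(* The path [c] prolonged by [j]; only its values up to time t + 1 matter. *)
pose s k := if (k <= t)%N then tnth c (inord k) else j.
rewrite (@path_uptoE t c s); last first.
  by move=> k; rewrite /s -ltnS ltn_ord inord_val.
have st : s t = i.
  by rewrite /s leqnn -Xtw -cw tnth_mktuple inordK.
have sj : s t.+1 = j by rewrite /s ltnn.
have -> : P i j = P (s t) (s t.+1) by rewrite st sj.
rewrite muleC -(Xchain.2 s t); congr (Pr _).
apply/seteqP; split => v /=.
  move=> [sv vj] k; rewrite leq_eqVlt => /predU1P[->|]; first by rewrite vj sj.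
  by rewrite ltnS; apply: sv.
by move=> sv; split; [move=> k kt; apply: sv; exact: leqW|rewrite sv].
Qed.

(** Induction on [a], conditioning on the state at time t + 1. The event X t = i is then absorbed
    into the known event, which is why [B] is arbitrary. *)
Lemma markov_nstep a t B i j : known_at t B ->
  Pr (B `&` [set w | X t w = i] `&` [set w | X (t + a)%N w = j]) =
  Pr (B `&` [set w | X t w = i]) * nstep P a i j.
Proof.
elim: a t B i => [|a IH] t B i kB.
  rewrite addn0 /=; case: eqP => [->|ij].
    by rewrite mule1 -setIA setIid.
  rewrite mule0 (_ : _ `&` _ = set0) ?measure0//.
  by apply/seteqP; split => // w [[_ /= ->]].
have kBi : known_at t (B `&` [set w | X t w = i]).
  by apply: known_atI => //; exact: (@known_at_preimage t t [set i]).
have mBi := measurable_known_at kBi.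
rewrite (measure_partition Pr (mX t.+1) (measurableI _ _ mBi (mX _ _))).
rewrite [nstep _ _ _ _]/=.
have /fineK <- : Pr (B `&` [set w | X t w = i]) \is a fin_num.
  exact: fin_num_measure.
rewrite -esumZl; last 2 first.
- by rewrite fine_ge0.
- by move=> k; rewrite mule_ge0 ?nstep_ge0// lee_fin; case: Pstoch.
rewrite fineK ?fin_num_measure//.
apply: eq_esum => k _; rewrite (setIAC (B `&` _)) -addSnnS.
apply: etrans (IH t.+1 _ k _) _; first exact: known_at_le kBi.
by rewrite markov_step// muleA.
Qed.

(** * A conditional Borel-Cantelli lemma *)

(** Each [G k] gives [H k] a chance of at least [eps] whatever the past, so infinitely many [G k]
    cannot all fail to produce some late [H k]. [H k] is decided only [a] time units after [T k];
    the growth of [T] ensures that it is known at [T l] once [l] is at least k + a. *)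
Lemma conditional_borel_cantelli (T : nat -> nat) (a : nat) (eps : R)
    (G H : nat -> set Omega) :
  (forall k l b, (k + b <= l)%N -> (T k + b <= T l)%N) -> (0 < eps)%R ->
  (forall k, known_at (T k) (G k)) -> (forall k, known_at (T k + a) (H k)) ->
  (forall k B, known_at (T k) B ->
    eps%:E * Pr (B `&` G k) <= Pr (B `&` G k `&` H k)) ->
  {ae Pr, forall w, (\forall k \near \oo, ~ H k w) ->
                    \forall k \near \oo, ~ G k w}.
Proof.
move=> Tinc eps0 kG kH GH.
have mG k := measurable_known_at (kG k).
have mH k := measurable_known_at (kH k).
have T_le k l : (k <= l)%N -> (T k <= T l)%N.
  by move=> kl; have := Tinc k l 0%N; rewrite !addn0 => ->.
have Ta k u l : (k <= u)%N -> (u + a <= l)%N -> (T k + a <= T l)%N.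
  move=> ku ul; apply: Tinc; apply: leq_trans ul; exact: leq_add.
suff H0 N : {ae Pr, forall w, (forall k, (N <= k)%N -> ~ H k w) ->
                    \forall k \near \oo, ~ G k w}.
  have := ae_foralln H0; apply: filterS => w Hw [N _ HN].
  by apply: (Hw N) => k Nk; exact: HN.
pose K u := \bigcap_(k in [set k | (N <= k <= N + u)%N]) ~` H k.
pose E u := K u `&` \bigcup_(k in [set k | (N + u + a <= k)%N]) G k.
pose Q := \bigcap_u E u.
have mK u : measurable (K u).
  apply: bigcap_measurableType => k _; exact: measurableC.
have mE u : measurable (E u).
  by apply: measurableI => //; apply: bigcup_measurable.
have mQ : measurable Q by apply: bigcapT_measurable.
suff Q0 : Pr Q = 0.
  exists Q; split => // w /= /not_implyP[nH nG] u _; split.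
    by move=> k /andP[Nk _]; exact: nH.
  apply: contrapT => nE; apply: nG; exists (N + u + a)%N => // k /= uk Gk.
  by apply: nE; exists k.
have fin_aux (x y : \bar R) : x \is a fin_num -> y \is a fin_num ->
    eps%:E * x <= y -> x - y <= (1 - eps)%:E * x.
  case: x y => [x| |] [y| |]// _ _.
  by rewrite -!EFinM -EFinB !lee_fin mulrBl mul1r lerD2l lerN2.
(* Q is the event that G occurs infinitely often but no H k with k >= N does,
   and E u decreases to Q. Split E u along the first k >= N + u + a for which
   G k occurs: on each piece, H k fails with probability at most 1 - eps. *)
have QE u : Pr Q <= (1 - eps)%:E * Pr (E u).
  pose F k := if (N + u + a <= k)%N then K u `&` G k else set0.
  have kF i k : (i <= k)%N -> known_at (T k) (F i).
    rewrite /F; case: ifP => [uk|_] ik; last by [];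
      apply: known_at_le (T_le _ _ ik) _.
    apply: known_atI => //; apply: known_at_bigcap => j /andP[_ ju].
    apply: known_atC; apply: known_at_le (Ta _ _ _ ju uk) (kH j).
  have kD k : known_at (T k) (seqDU F k).
    rewrite /seqDU setDE; apply: known_atI; first exact: kF.
    apply: known_atC; apply: big_ind => //; first exact: known_atU.
    by move=> i _; apply: kF; exact: ltnW.
  have mD k := measurable_known_at (kD k).
  have DG k : seqDU F k `&` G k = seqDU F k.
    by apply/setIidPl => w Dw; have := subset_seqDU Dw; rewrite /F;
      case: ifP => // _ [].
  have EF : E u = \bigcup_k seqDU F k.
    rewrite -seqDU_bigcup_eq; apply/seteqP; split => w /=.
      by move=> [Kw [k /= uk Gk]]; exists k => //; rewrite /F uk.
    by move=> [k _]; rewrite /F; case: ifP => // uk [Kw Gk]; split => //;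
      exists k.
  have QD : Q `<=` \bigcup_k (seqDU F k `\` H k).
    move=> w Qw; have : (\bigcup_k seqDU F k) w by rewrite -EF; exact: Qw.
    move=> [k _ Dk]; exists k => //; split => //.
    have := subset_seqDU Dk; rewrite /F; case: ifP => // uk _.
    have Kk : (N <= k <= N + k)%N.
      by rewrite leq_addl (leq_trans _ uk)// -addnA leq_addr.
    by have [/(_ k Kk)] := Qw k I.
  apply: le_trans (measure_sigma_subadditive Pr _ mQ QD) _.
    by move=> k; apply: measurableD.
  rewrite EF measure_bigcup//.
  under [in leRHS]eq_eseriesl do rewrite in_setT.
  rewrite -nneseriesZl//; apply: lee_nneseries => // k _.
  rewrite measureD//; last by rewrite ltey_eq fin_num_measure.
  apply: fin_aux;
    [exact: fin_num_measure| |by have := GH k _ (kD k); rewrite DG].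
  by apply: fin_num_measure; exact: measurableI.
have cvE : Pr (E u) @[u --> \oo] --> Pr Q.
  apply: nonincreasing_cvg_mu => //.
    by rewrite ltey_eq fin_num_measure.
  move=> u v uv; apply/subsetPset => w [Kw [k /= vk Gk]]; split.
    move=> j /andP[Nj ju]; apply: Kw; rewrite /= Nj (leq_trans ju)//.
    by rewrite leq_add2l.
  by exists k => //=; apply: leq_trans vk; rewrite leq_add2r leq_add2l.
(* Letting [u] tend to infinity in [QE] makes [Q] bound itself with a factor below 1. *)
have : Pr Q <= (1 - eps)%:E * Pr Q.
  by apply: cvge_ge (cvgeZl _ cvE) => //; exact: nearW.
have /fineK <- : Pr Q \is a fin_num by exact: fin_num_measure.
rewrite -EFinM lee_fin mulrBl mul1r lerBrDl gerDr => Q0; congr EFin.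
apply/eqP; rewrite eq_le fine_ge0// andbT.
by rewrite -(pmulr_rle0 _ eps0).
Qed.

Lemma nstep1 i j : nstep P 1 i j = (P i j)%:E.
Proof.
have P0 := Pstoch.1.
rewrite /= (esumID [set j]) => [|k _]; last first.
  by case: eqP; rewrite ?mule1 ?mule0 ?lee_fin.
rewrite setTI esum_set1 ?eqxx ?mule1 ?lee_fin// [X in _ + X]esum1 ?adde0//.
by move=> k [_ /= /eqP/negbTE ->]; rewrite mule0.
Qed.

Lemma markov_nstep_set a t B i (A : set S) : known_at t B ->
  Pr (B `&` [set w | X t w = i] `&` [set w | A (X (t + a)%N w)]) =
  Pr (B `&` [set w | X t w = i]) * \esum_(j in A) nstep P a i j.
Proof.
move=> kB; have mB := measurable_known_at kB.
have mA : measurable [set w | A (X (t + a)%N w)].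
  by apply: (measurable_known_at (t := (t + a)%N)); exact: known_at_preimage.
rewrite (measure_partition Pr (fun j => mX (t + a) j)); last first.
  by apply: measurableI => //; exact: measurableI.
rewrite [in RHS]esum_mkcond.
have /fineK <- : Pr (B `&` [set w | X t w = i]) \is a fin_num.
  by apply: fin_num_measure => //; exact: measurableI.
rewrite -esumZl; first last.
- by move=> j; case: ifP => // _; exact: nstep_ge0.
- by rewrite fine_ge0.
apply: eq_esum => j _; case: ifPn; rewrite ?inE ?notin_setE => Aj; last first.
  rewrite mule0 (_ : _ `&` _ = set0) ?measure0//.
  by apply/seteqP; split => // w [[_ /= Aw] wj]; apply: Aj; rewrite -wj.
rewrite fineK; last by apply: fin_num_measure => //; exact: measurableI.
rewrite -markov_nstep//; congr (Pr _); apply/seteqP; split => w /=.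
  by move=> [[? _] ?].
by move=> [? wj]; split => //; split => //; rewrite wj.
Qed.

(** The target [Q i] may depend on the current state [i], so that both entrance into a fixed set and
    return to the starting state are covered. *)
Lemma transition_io m s a (eps : R) (E : set S) (Q : S -> set S) :
  (0 < m)%N -> (0 < eps)%R ->
  (forall i, E i -> eps%:E <= \esum_(j in Q i) nstep P a i j) ->
  {ae Pr, forall w,
    (\forall k \near \oo, ~ (E (X (s + k * m)%N w) /\
       Q (X (s + k * m)%N w) (X (s + k * m + a)%N w))) ->
    \forall k \near \oo, ~ E (X (s + k * m)%N w)}.
Proof.
move=> m0 eps0 EQ.
apply: (conditional_borel_cantelli (T := fun k => (s + k * m)%N)
  (a := a) (eps := eps) (G := fun k => [set w | E (X (s + k * m)%N w)])
  (H := fun k => [set w | E (X (s + k * m)%N w) /\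
       Q (X (s + k * m)%N w) (X (s + k * m + a)%N w)])) => //.
- move=> k l b kl; rewrite -addnA leq_add2l.
  apply: leq_trans (leq_mul kl (leqnn m)); rewrite mulnDl leq_add2l.
  by rewrite leq_pmulr.
- by move=> k; exact: known_at_preimage.
- by move=> k w w' ww' /=; rewrite !ww'//; exact: leq_addr.
move=> k B kB; set t := (s + k * m)%N; set G := [set w | E (X t w)].
have kG : known_at t G by exact: known_at_preimage.
have kBG : known_at t (B `&` G) by exact: known_atI.
have kH : known_at (t + a) [set w | E (X t w) /\ Q (X t w) (X (t + a)%N w)].
  by move=> w w' ww' /=; rewrite !ww'//; exact: leq_addr.
have mBG := measurable_known_at kBG.
have mH := measurable_known_at kH.
rewrite (measure_partition Pr (mX t) mBG).
rewrite [leRHS](measure_partition Pr (mX t) (measurableI _ _ mBG mH)).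
rewrite -esumZl//; last exact: ltW.
apply: le_esum => i _.
have [Ei|nEi] := pselect (E i); last first.
  rewrite (_ : _ `&` _ = set0) ?measure0 ?mule0//.
  by apply/seteqP; split => // w [[_ /= Ew] wi]; apply: nEi; rewrite -wi.
rewrite [in leRHS](_ : _ `&` _ = B `&` G `&` [set w | X t w = i] `&`
   [set w | Q i (X (t + a)%N w)]); last first.
  apply/seteqP; split => w /=.
    by move=> [[[Bw Gw] [_ Qw]] <-].
  by move=> [[[Bw Gw] wi]]; rewrite -wi.
rewrite [leRHS](markov_nstep_set a i (Q i) kBG) muleC; apply: lee_wpmul2l => //.
exact: EQ.
Qed.

(** * The law of the future and its independence of the starting time *)

Definition future s (w : Omega) (k : nat) : S := X (s + k)%N w.

Definition future_in (E : set (nat -> S)) s : set Omega :=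
  [set w | E (future s w)].

Lemma known_at_future E N s :
  (forall p p', (forall k, (k <= N)%N -> p k = p' k) -> E p -> E p') ->
  known_at (s + N) (future_in E s).
Proof.
move=> hE w w' ww'; apply: hE => k kN; rewrite /future ww'//.
by rewrite leq_add2l.
Qed.

(* The law of the future given X s = j does not depend on s. It is stated with
   cross products, as X s = j may have probability 0. *)
Lemma cylinder_proportional (c : nat -> S) N s t :
  Pr (future_in [set p | forall k, (k <= N)%N -> p k = c k] s) *
    Pr [set w | X t w = c 0%N] =
  Pr (future_in [set p | forall k, (k <= N)%N -> p k = c k] t) *
    Pr [set w | X s w = c 0%N].
Proof.
pose B N s := future_in [set p | forall k, (k <= N)%N -> p k = c k] s.
have B0 u : B 0%N u = [set w | X u w = c 0%N].
  apply/seteqP; split => w /=; first by move/(_ 0%N (leqnn _));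
    rewrite /future addn0.
  by move=> wc k; rewrite leqn0 => /eqP ->; rewrite /future addn0.
have BS n u : Pr (B n.+1 u) = Pr (B n u) * (P (c n) (c n.+1))%:E.
  have kB : known_at (u + n) (B n u).
    by apply: known_at_future => p p' pp' /= pc k kn; rewrite -pp'// pc.
  have -> : B n u = B n u `&` [set w | X (u + n)%N w = c n].
    by apply/esym/setIidPl => w /(_ n (leqnn n)).
  rewrite -markov_step//; congr (Pr _); apply/seteqP; split => w /=.
    move=> wc; split; last by rewrite -addnS; exact: wc.
    split; last exact: wc.
    by move=> k kn; apply: wc; exact: leqW.
  move=> [[wc _] wn] k; rewrite leq_eqVlt => /predU1P[->|]; last exact: wc.
  by rewrite /future addnS.
rewrite -/(B N s) -/(B N t); elim: N => [|n IH]; first by rewrite !B0 muleC.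
by rewrite !BS muleAC IH muleAC.
Qed.

(** Cut along the next N + 1 states, which decide [E]: each piece contributes 0 on both sides or is
    a cylinder, handled by [cylinder_proportional]. *)
Lemma finite_horizon_proportional E s t j : finite_horizon E ->
  Pr ([set w | X s w = j] `&` future_in E s) * Pr [set w | X t w = j] =
  Pr ([set w | X t w = j] `&` future_in E t) * Pr [set w | X s w = j].
Proof.
move=> [N hE].
pose f u w : N.+1.-tuple S := [tuple future u w k | k < N.+1].
have fE u (c : N.+1.-tuple S) : [set w | f u w = c] =
    future_in [set p | forall k, (k <= N)%N -> p k = tnth c (inord k)] u.
  apply/seteqP; split => w /=.
    by move=> <- k kN; rewrite tnth_mktuple inordK.
  move=> wc; apply: eq_from_tnth => k; rewrite tnth_mktuple wc ?inord_val//.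
  by rewrite -ltnS.
have mf u c : measurable [set w | f u w = c].
  rewrite fE; apply: (measurable_known_at (t := (u + N)%N)).
  by apply: known_at_future => p p' pp' /= pc k kN; rewrite -pp'// pc.
have mE u : measurable (future_in E u).
  by apply: (measurable_known_at (t := (u + N)%N)); exact: known_at_future.
rewrite [in LHS](measure_partition Pr (mf s) (measurableI _ _ (mX s j) (mE s))).
rewrite [in RHS](measure_partition Pr (mf t) (measurableI _ _ (mX t j) (mE t))).
have /fineK <- : Pr [set w | X t w = j] \is a fin_num by exact: fin_num_measure.
have /fineK <- : Pr [set w | X s w = j] \is a fin_num by exact: fin_num_measure.
rewrite muleC [RHS]muleC -!esumZl ?fine_ge0//.
apply: eq_esum => c _; rewrite !fineK ?fin_num_measure//.
have [[cj Ec]|nc] :=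
    pselect (tnth c ord0 = j /\ E (fun k => tnth c (inord k))); last first.
  have E0 u :
      [set w | X u w = j] `&` future_in E u `&` [set w | f u w = c] = set0.
    apply/seteqP; split => // w /= [[wj Ew] wc]; apply: nc; rewrite -wc; split.
      by rewrite tnth_mktuple /future addn0.
    by apply: hE Ew => k kN; rewrite tnth_mktuple inordK.
  by rewrite !E0 measure0 !mule0.
have E1 u : [set w | X u w = j] `&` future_in E u `&` [set w | f u w = c] =
    [set w | f u w = c].
  apply/setIidPr => w /= wc; split.
    by rewrite -cj -wc tnth_mktuple /future addn0.
  by apply: hE Ec => k kN; rewrite -wc tnth_mktuple inordK.
rewrite !E1 !fE muleC [RHS]muleC.
have := cylinder_proportional (fun k => tnth c (inord k)) N s t.
by rewrite (_ : inord 0 = ord0) ?cj//; apply: val_inj; rewrite /= inordK.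
Qed.

Lemma measurable_future_in E u : path_event E -> measurable (future_in E u).
Proof.
move: E; apply: smallest_sub.
  split=> [|E|F] /=.
  - by rewrite (_ : future_in _ _ = set0).
  - by rewrite setTD => mE; rewrite (_ : future_in _ _ = ~` future_in E u);
      [exact: measurableC|].
  - move=> mF; rewrite (_ : future_in _ _ = \bigcup_k future_in (F k) u)//.
    exact: bigcupT_measurable.
move=> E [N hE]; apply: (measurable_known_at (t := (u + N)%N)).
exact: known_at_future.
Qed.

(** Dynkin's pi-lambda theorem extends the identity from finite horizons. Finiteness of the
    probabilities permits the subtraction needed for complements. *)
Lemma future_proportional E s t j : path_event E ->
  Pr ([set w | X s w = j] `&` future_in E s) * Pr [set w | X t w = j] =
  Pr ([set w | X t w = j] `&` future_in E t) * Pr [set w | X s w = j].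
Proof.
move=> hE; have mE := measurable_future_in _ hE; move: E hE {mE}.
pose H : set (set (nat -> S)) := [set E | path_event E /\
  Pr ([set w | X s w = j] `&` future_in E s) * Pr [set w | X t w = j] =
  Pr ([set w | X t w = j] `&` future_in E t) * Pr [set w | X s w = j]].
suff HE : path_event `<=` H by move=> E /HE[].
apply: lambda_system_subset => //; first exact: finite_horizonI.
  apply/dynkin_lambda_system; split.
  - split; first by rewrite -setC0; apply: path_eventC; exact: sigma_algebra0.
    rewrite (_ : future_in _ _ = setT)// (_ : future_in _ _ = setT)//.
    by rewrite !setIT muleC.
  - move=> E [hE EE]; split; first exact: path_eventC.
    have CE u : Pr ([set w | X u w = j] `&` future_in (~` E) u) =
        Pr [set w | X u w = j] - Pr ([set w | X u w = j] `&` future_in E u).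
      rewrite -measureD//; first exact: measurable_future_in.
      by rewrite ltey_eq fin_num_measure.
    rewrite !CE !muleBl; last 4 first.
    + by rewrite fin_num_measure.
    + by rewrite fin_num_adde_defr// fin_num_measure.
    + by rewrite fin_num_measure.
    + by rewrite fin_num_adde_defr// fin_num_measure.
    by rewrite EE muleC.
  - move=> F tF HF; split; first by apply: path_event_bigcup => k; case: (HF k).
    have bF u : Pr ([set w | X u w = j] `&` future_in (\bigcup_k F k) u) =
        \sum_(0 <= k <oo) Pr ([set w | X u w = j] `&` future_in (F k) u).
      rewrite (_ : _ `&` _ =
          \bigcup_k ([set w | X u w = j] `&` future_in (F k) u)).
        rewrite measure_bigcup//.
        + by under eq_eseriesl do rewrite in_setT.
        + move=> k _; apply: measurableI => //; apply: measurable_future_in.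
          by case: (HF k).
        + apply/trivIsetP => k l _ _ kl; apply/seteqP;
            split => // w /= [[_ Fk] [_ Fl]].
          move/trivIsetP : tF => /(_ k l I I kl) /seteqP[/(_ (future u w))].
          by move=> h _; apply: h.
      by rewrite setI_bigcupr.
    rewrite !bF muleC [RHS]muleC.
    have /fineK <- : Pr [set w | X t w = j] \is a fin_num.
      exact: fin_num_measure.
    have /fineK <- : Pr [set w | X s w = j] \is a fin_num.
      exact: fin_num_measure.
    rewrite -!nneseriesZl//; apply: eq_eseriesr => k _.
    rewrite !fineK ?fin_num_measure//.
    by rewrite muleC (HF k).2 muleC.
move=> E hE; split; first exact: sub_sigma_algebra.
exact: finite_horizon_proportional.
Qed.

(** Aperiodicity removes the dependence on the residue. Given X s' = j, the future has the same law
    as given X (s' + a) = j, and [a] can be chosen with s' + a congruent to [s] mod [m]. Invariance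
    of [E] under shifts by [m] then makes its failure negligible. *)
Lemma future_ae_transfer E m s s' : (0 < m)%N -> path_event E ->
  (forall p, E p <-> E (fun k => p (m + k)%N)) ->
  {ae Pr, forall w, E (future s w)} -> {ae Pr, forall w, E (future s' w)}.
Proof.
move=> m0 hE Em Es.
have hC := path_eventC hE.
have shift u w k : E (future (u + k * m)%N w) <-> E (future u w).
  elim: k => [|k IH]; first by rewrite addn0.
  rewrite -IH (Em (future (u + k * m) w)).
  rewrite (_ : (fun _ => _) = future (u + k.+1 * m)%N w)//.
  by apply/funext => i; rewrite /future mulSnr !addnA.
have shiftm u v w : u = v %[mod m] -> E (future u w) <-> E (future v w).
  move=> uv; rewrite (divn_eq u m) (divn_eq v m) uv addnC (addnC _ (v %% m)%N).
  by rewrite !shift.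
have nE u : {ae Pr, forall w, E (future u w)} <-> Pr (future_in (~` E) u) = 0.
  by apply: iff_trans (negligibleP _ (measurable_future_in u hC)).
apply/nE.
have mCs := measurable_future_in s' hC.
rewrite (measure_partition Pr (mX s') mCs) esum1// => j _.
have [p0|p0] := eqVneq (Pr [set w | X s' w = j]) 0.
  by apply: subset_measure0 p0 => //; exact: measurableI.
(* Quantifying over all [t] makes [T] additive; it contains the return times of [j], whose gcd is
   1. *)
pose T a := forall t,
  0 < Pr [set w | X t w = j] -> 0 < Pr [set w | X (t + a)%N w = j].
(* The residue asked for is that of s - s', written without negative numbers. *)
have [|||a Ta aE] :=
  @residues_of_return_times T m m0 _ _ _ (s + (m - s' %% m))%N.
- by move=> t; rewrite addn0.
- by move=> a b Ta Tb t /Ta /Tb; rewrite addnA.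
- move=> q qT; have [_ /(_ q)] := Paper j; apply => a [a0 Pa].
  apply: qT => t pt.
  have := markov_nstep a j j (@known_at_preimage t t setT (leqnn t)).
  rewrite !setTI => E1; apply: lt_le_trans (_ :
    Pr ([set w | X t w = j] `&` [set w | X (t + a)%N w = j]) <= _).
    by rewrite E1 mule_gt0.
  by rewrite le_measure ?inE//; exact: measurableI.
have tE : (s' + a)%N = s %[mod m].
  rewrite -modnDm aE modnDm addnC -addnA -modnDmr -(modnDmr _ s').
  by rewrite subnK ?modnn ?addn0// ltnW// ltn_mod.
have := future_proportional s' (s' + a)%N j hC.
have -> : Pr ([set w | X (s' + a)%N w = j] `&` future_in (~` E) (s' + a)%N) = 0.
  apply: subset_measure0 ((nE s).1 Es).
  - by apply: measurableI => //; exact: measurable_future_in.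
  - exact: measurable_future_in.
  - by move=> w [_ nEw] Ew; apply: nEw; apply/(shiftm _ _ _ tE).
rewrite mul0e => /eqP; rewrite mule_eq0 setIC => /orP[/eqP//|/eqP pj].
have : 0 < Pr [set w | X (s' + a)%N w = j].
  by apply: Ta; rewrite lt0e p0 measure_ge0.
by rewrite pj ltxx.
Qed.

(** * Eventual membership along a residue class *)

Implicit Types (A B C : set S).

(** Quantifying over all large [t], rather than over r + k * m, makes a change of [r] mod [m] or of
    [m] into a multiple immediate. [evP] gives the other form. *)
Definition ev m r A : set Omega :=
  [set w | \forall t \near \oo, t = r %[mod m] -> A (X t w)].

Lemma evP m r A w : (0 < m)%N ->
  ev m r A w <-> \forall k \near \oo, A (X (r + k * m)%N w).
Proof.
move=> m0; split=> -[N _ NA].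
  exists N => // k /= Nk; apply: NA; last by rewrite addnC modnMDl.
  by rewrite /= (leq_trans Nk)// (leq_trans (leq_pmulr k m0))// leq_addl.
exists (r + N * m)%N => // t /= Nt tr.
have rt : (r <= t)%N by rewrite (leq_trans _ Nt)// leq_addr.
have /dvdnP[k kE] : (m %| t - r)%N by rewrite -eqn_mod_dvd//; apply/eqP.
have tE : (t = r + k * m)%N by rewrite -kE subnKC.
rewrite tE; apply: NA => /=; move: Nt; rewrite tE leq_add2l leq_pmul2r//.
Qed.

Lemma ev_mod m r r' A w : r = r' %[mod m] -> ev m r A w -> ev m r' A w.
Proof. by move=> rr'; apply: filterS => t tA tr; apply: tA; rewrite rr'. Qed.

Lemma ev_dvd m n r A w : (m %| n)%N -> ev m r A w -> ev n r A w.
Proof.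
move=> mn; apply: filterS => t tA tr; apply: tA.
by rewrite -(modn_dvdm t mn) tr modn_dvdm.
Qed.

Lemma evS m r A B w : A `<=` B -> ev m r A w -> ev m r B w.
Proof. by move=> AB; apply: filterS => t tA /tA /AB. Qed.

Lemma evI m r A B w : ev m r A w -> ev m r B w -> ev m r (A `&` B) w.
Proof. by apply: filterS2 => t tA tB tr; split; [exact: tA|exact: tB]. Qed.

Lemma ev_meet m r A B w : (0 < m)%N -> ev m r A w -> ev m r B w ->
  exists x, A x /\ B x.
Proof.
move=> m0; rewrite !evP// => evA evB.
have [N _ /(_ N (leqnn N)) AB] := filterI evA evB.
by exists (X (r + N * m)%N w).
Qed.

Lemma ev_disjoint m r A B w : (0 < m)%N -> A `&` B = set0 ->
  ev m r A w -> ev m r B w -> False.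
Proof.
move=> m0 AB Aw Bw; have [x xAB] := ev_meet m0 Aw Bw.
by move/seteqP : AB => [/(_ x xAB)].
Qed.

Lemma ev_future m r A w : (0 < m)%N -> ev m r A w <->
  future_in [set p | \forall k \near \oo, A (p (k * m)%N)] r w.
Proof. exact: evP. Qed.

Lemma measurable_ev m r A : (0 < m)%N -> measurable (ev m r A).
Proof.
move=> m0; rewrite (_ : ev m r A =
  future_in [set p | \forall k \near \oo, A (p (k * m)%N)] r); last first.
  by apply/seteqP; split => w /(ev_future _ _ _ m0).
by apply: measurable_future_in; exact: path_event_near.
Qed.

(** Almost sure statements can be combined as filters; [regularP] and [transientP] relate them to
    null events of the chain X^(m). *)
Definition regular_ae m A : Prop :=
  {ae Pr, forall w, ev m 0 A w \/ ev m 0 (~` A) w}.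

Definition transient_ae m A : Prop := {ae Pr, forall w, ev m 0 (~` A) w}.

Lemma eventually_in_mstep m A w : (0 < m)%N ->
  eventually_in (mstep_chain X m) A w <-> ev m 0 A w.
Proof. by move=> m0; rewrite (evP 0 A w m0). Qed.

Lemma infinitely_often_mstep m A w : (0 < m)%N ->
  infinitely_often (mstep_chain X m) A w <-> ~ ev m 0 (~` A) w.
Proof.
move=> m0; rewrite (evP 0 (~` A) w m0); split.
  by move=> io [N _ NA]; have [k /= Nk Ak] := io N I; apply: (NA k).
move=> nev N _; apply: contrapT => nA; apply: nev; exists N => // k /= Nk Ak.
by apply: nA; exists k.
Qed.

Lemma transientP m A : (0 < m)%N ->
  transient Pr (mstep_chain X m) A <-> transient_ae m A.
Proof.
move=> m0; rewrite /transient.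
have -> : infinitely_often (mstep_chain X m) A = ~` ev m 0 (~` A).
  by apply/seteqP; split => w /(infinitely_often_mstep _ _ m0).
apply: iff_sym; apply: iff_trans (negligibleP _ _); first by [].
by apply: measurableC; exact: measurable_ev.
Qed.

Lemma regularP m A : (0 < m)%N ->
  regular Pr (mstep_chain X m) A <-> regular_ae m A.
Proof.
move=> m0; rewrite /regular.
have -> : infinitely_often (mstep_chain X m) A `\`
    eventually_in (mstep_chain X m) A =
    ~` [set w | ev m 0 A w \/ ev m 0 (~` A) w].
  apply/seteqP; split => w /=.
    move=> [/(infinitely_often_mstep _ _ m0) nC nA] [Aw|//].
    by apply: nA; apply/(eventually_in_mstep _ _ m0).
  move=> /not_orP[nA nC]; split; first exact/(infinitely_often_mstep _ _ m0).
  by move=> /(eventually_in_mstep _ _ m0).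
apply: iff_sym; apply: iff_trans (negligibleP _ _); first by [].
by apply: measurableC; apply: measurableU; exact: measurable_ev.
Qed.

Lemma almost_closedP m A : (0 < m)%N ->
  almost_closed Pr (mstep_chain X m) A <-> regular_ae m A /\ ~ transient_ae m A.
Proof.
move=> m0; rewrite /almost_closed; have := regularP A m0;
  have := transientP A m0.
by tauto.
Qed.

(** Looking at another residue amounts to changing the initial law of X^(m), to which transience is
    insensitive by [future_ae_transfer]. [regular_ae_all] does the same for regularity. *)
Lemma transient_ae_all m A r : (0 < m)%N ->
  {ae Pr, forall w, ev m r (~` A) w} ->
  forall r', {ae Pr, forall w, ev m r' (~` A) w}.
Proof.
move=> m0 Ar r'.
have inv p := near_mulnD m (fun k => (~` A) (p k)).
have h := future_ae_transfer (s := r) r' m0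
  (path_event_near (fun k => k * m)%N (~` A)) inv.
apply: filterS (h _) => [w /(ev_future _ _ _ m0)//|].
by apply: filterS Ar => w /(ev_future _ _ _ m0).
Qed.

Lemma regular_ae_all m A : (0 < m)%N -> regular_ae m A ->
  {ae Pr, forall w r, ev m r A w \/ ev m r (~` A) w}.
Proof.
move=> m0 rA; apply: ae_foralln => r.
have pe := path_eventU (path_event_near (fun k => k * m)%N A)
  (path_event_near (fun k => k * m)%N (~` A)).
have inv p := near_mulnD m (fun k => A (p k)).
have invC p := near_mulnD m (fun k => (~` A) (p k)).
have h := future_ae_transfer (m := m) (s := 0) r m0 pe.
apply: filterS (h _ _) => [w|p|].
- by case => [/(ev_future _ _ _ m0)|/(ev_future _ _ _ m0)]; [left|right].
- split; first by case=> h1; [left; exact: (inv p).1|right; exact: (invC p).1].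
  by case=> h1; [left; exact: (inv p).2|right; exact: (invC p).2].
- move: rA; rewrite /regular_ae; apply: filterS => w.
  by case=> [/(ev_future _ _ _ m0)|/(ev_future _ _ _ m0)]; [left|right].
Qed.

(** * Shifting a regular set in time *)

(* If A is regular at the times congruent to r + 1 mod m, conditional
   Borel-Cantelli forces the transition probability into A at the preceding
   times to tend to 1 on the event that X ends up in A, and to 0 off it. Hence
   pullback A is A seen one time unit earlier. *)
Definition pullback A : set S :=
  [set i | 2^-1%:E <= \esum_(j in A) (P i j)%:E].

Lemma ev_transition m s a (eps : R) (E : set S) (Q : S -> set S) :
  (0 < m)%N -> (0 < eps)%R ->
  (forall i, E i -> eps%:E <= \esum_(j in Q i) nstep P a i j) ->
  {ae Pr, forall w,
    (\forall t \near \oo, t = s %[mod m] ->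
      ~ (E (X t w) /\ Q (X t w) (X (t + a)%N w))) ->
    ev m s (~` E) w}.
Proof.
move=> m0 eps0 EQ; apply: filterS (transition_io s m0 eps0 EQ).
move=> w h tE; apply/evP => //; apply: h.
case: tE => N _ NE; exists N => // k /= Nk; apply: NE;
  last by rewrite addnC modnMDl.
by rewrite /= (leq_trans Nk)// (leq_trans (leq_pmulr k m0))// leq_addl.
Qed.

(** Infinitely many visits to [E] at residue [s] would almost surely produce infinitely many visits
    to [A] one step later. *)
Lemma ev_pullback_half m s (E A : set S) : (0 < m)%N ->
  (forall i, E i -> 2^-1%:E <= \esum_(j in A) (P i j)%:E) ->
  {ae Pr, forall w, ev m s.+1 (~` A) w -> ev m s (~` E) w}.
Proof.
move=> m0 EA.
have h2 : (0 < 2^-1 :> R)%R by rewrite invr_gt0.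
have EA1 i : E i -> 2^-1%:E <= \esum_(j in A) nstep P 1 i j.
  by move=> Ei; under eq_esum do rewrite nstep1//; exact: EA.
apply: filterS (ev_transition s m0 h2 EA1) => w h nA; apply: h.
case: nA => N _ NA; exists N => // t /= Nt ts [_ Aw].
apply: (NA (t + 1)%N) Aw; first by rewrite /= (leq_trans Nt)// leq_addr.
by rewrite -modnDml ts modnDml addn1.
Qed.

(** One direction of each equivalence is [ev_pullback_half], for [A] and for its complement.
    Regularity of [A] leaves only these two alternatives, which yields the converses. *)
Lemma ev_pullback m A : (0 < m)%N -> regular_ae m A ->
  {ae Pr, forall w r, (ev m r (pullback A) w <-> ev m r.+1 A w) /\
    (ev m r (~` pullback A) w <-> ev m r.+1 (~` A) w)}.
Proof.
move=> m0 rA; apply: ae_foralln => r.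
have pA : {ae Pr, forall w, ev m r.+1 (~` A) w -> ev m r (~` pullback A) w}.
  exact: ev_pullback_half.
have pC : {ae Pr, forall w, ev m r.+1 A w -> ev m r (pullback A) w}.
  (* Rows sum to 1, so a state sending mass less than 1/2 into [A] sends at least 1/2 outside. *)
  have half i : (~` pullback A) i -> 2^-1%:E <= \esum_(j in ~` A) (P i j)%:E.
    move=> /negP; rewrite -ltNge => lA; rewrite leNgt; apply/negP => lC.
    have := lteD lA lC; rewrite -EFinD -[2^-1%R]mul1r -splitr.
    have P0 j : 0 <= (P i j)%:E by rewrite lee_fin; case: Pstoch.
    have := esumID A [set: S] (fun j => (P i j)%:E) (fun j _ => P0 j).
    by rewrite !setTI Pstoch.2 => <-; rewrite ltxx.
  have := ev_pullback_half r m0 half; rewrite !setCK; exact.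
apply: filterS3 (regular_ae_all m0 rA) pA pC => w rw Aw Cw.
split; split=> [h|]; [|exact: Cw| |exact: Aw].
  by case: (rw r.+1) => // /Aw/ev_disjoint => /(_ _ m0 (setICl _) h).
by case: (rw r.+1) => // /Cw/ev_disjoint => /(_ _ m0 (setICr _) h).
Qed.

Lemma ev_iter_pullback m A n : (0 < m)%N -> regular_ae m A ->
  {ae Pr, forall w r, (ev m r (iter n pullback A) w <-> ev m (r + n) A w) /\
    (ev m r (~` iter n pullback A) w <-> ev m (r + n) (~` A) w)}.
Proof.
move=> m0 rA; elim: n => [|n IH].
  by apply: aeW => w r; rewrite addn0.
have rn : regular_ae m (iter n pullback A).
  apply: filterS2 (regular_ae_all m0 rA) IH => w rw IHw.
  by have [-> ->] := IHw 0%N; exact: rw.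
apply: filterS2 IH (ev_pullback m0 rn) => w IHw pw r /=.
by have [-> ->] := pw r; rewrite addnS -addSn; exact: IHw.
Qed.

(** Joining the shifts by all [r] below [m] removes the dependence on the residue of the time:
    almost surely X ends up in this set exactly when it ends up in [A] along some residue class
    ([ev_hull_inv]). *)
Definition hull m A : set S := [set i | exists r : 'I_m, iter r pullback A i].

Lemma ev_hull m A : (0 < m)%N -> regular_ae m A ->
  {ae Pr, forall w, ((exists r, ev m r A w) -> ev 1 0 (hull m A) w) /\
    ((forall r, ev m r (~` A) w) -> ev 1 0 (~` hull m A) w)}.
Proof.
move=> m0 rA.
have := ae_foralln (fun n => ev_iter_pullback n m0 rA).
apply: filterS => w pw; split.
  move=> [r0 rA0].
  have evs (s : 'I_m) : \forall t \near \oo, t = s %[mod m] -> hull m A (X t w).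
    (* The shift for which s + r is congruent to [r0]. *)
    pose r := ((r0 + (m - s)) %% m)%N.
    have rm : (r < m)%N by rewrite ltn_mod.
    suff : ev m s (iter r pullback A) w.
      by apply: filterS => t tA /tA Ar; exists (Ordinal rm).
    have [-> _] := pw r s; apply: ev_mod rA0.
    by rewrite modnDmr addnCA subnKC ?modnDr// ltnW.
  apply: filterS (filter_forall _ evs) => t ht _.
  by apply: (ht (Ordinal (ltn_pmod t m0))); rewrite /= modn_mod.
move=> nA.
have evs (sr : 'I_m * 'I_m) : ev m sr.1 (~` iter sr.2 pullback A) w.
  by have [_ ->] := pw sr.2 sr.1; exact: nA.
apply: filterS (filter_forall _ evs) => t ht _ [r Ar].
by apply: (ht (Ordinal (ltn_pmod t m0), r) _ Ar); rewrite /= modn_mod.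
Qed.

Lemma ae_ex (Q : Omega -> Prop) : {ae Pr, forall w, Q w} -> exists w, Q w.
Proof.
have Pr0 : 0 < Pr [set: Omega] by rewrite probability_setT.
have pf := ae_properfilter_algebraOfSetsType Pr0.
by move=> /(@filter_ex _ _ pf).
Qed.

Lemma ev_of_1 m r A w : ev 1 0 A w -> ev m r A w.
Proof. by apply: filterS => t tA _; apply: tA; rewrite !modn1. Qed.

Lemma regular_ae_dvd m n A : (0 < m)%N -> (m %| n)%N ->
  regular_ae m A -> regular_ae n A.
Proof.
move=> m0 mn; rewrite /regular_ae; apply: filterS => w [|] /(ev_dvd mn);
  by [left|right].
Qed.

Lemma regular_aeI m A B :
  regular_ae m A -> regular_ae m B -> regular_ae m (A `&` B).
Proof.
rewrite /regular_ae; apply: filterS2 => w [Aw|Aw]; last by right;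
  apply: evS Aw => x nA [].
by case=> Bw; [left; exact: evI|right; apply: evS Bw => x nB []].
Qed.

Lemma regular_aeC m A : regular_ae m A -> regular_ae m (~` A).
Proof. by rewrite /regular_ae setCK; apply: filterS => w []; [right|left]. Qed.

(** The premises in [ev_hull] exhaust all cases and its conclusions exclude each other, so both
    implications reverse. *)
Lemma ev_hull_inv m A : (0 < m)%N -> regular_ae m A ->
  {ae Pr, forall w, ((exists r, ev m r A w) <-> ev 1 0 (hull m A) w) /\
    ((forall r, ev m r (~` A) w) <-> ev 1 0 (~` hull m A) w)}.
Proof.
move=> m0 rA;
  apply: filterS2 (regular_ae_all m0 rA) (ev_hull m0 rA) => w rw [hA hC].
have no : ev 1 0 (hull m A) w -> ev 1 0 (~` hull m A) w -> False.
  exact: ev_disjoint (setICr _).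
have [[r Ar]|nA] := pselect (exists r, ev m r A w).
  split; split; [exact: hA|by exists r|exact: hC|].
  by move=> /no; case; apply: hA; exists r.
have Cw r : ev m r (~` A) w by case: (rw r) => // Ar; case: nA; exists r.
split; split; [by []|by move=> hw; case: (no hw); exact: hC|by []|by []].
Qed.

Lemma regular_ae_hull m A : (0 < m)%N ->
  regular_ae m A -> regular_ae 1 (hull m A).
Proof.
move=> m0 rA;
  apply: filterS2 (regular_ae_all m0 rA) (ev_hull_inv m0 rA) => w rw [hA hC].
have [/hA|nA] := pselect (exists r, ev m r A w); first by left.
by right; apply/hC => r; case: (rw r) => // Ar; case: nA; exists r.
Qed.

Lemma transient_ae_hull m A : (0 < m)%N -> regular_ae m A ->
  transient_ae 1 (hull m A) -> transient_ae m A.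
Proof.
by move=> m0 rA; apply: filterS2 (ev_hull_inv m0 rA) => w [_ hC] /hC; exact.
Qed.

(** * Simple chains, atoms and the zero-one law *)

Lemma simple_cases (Y : nat -> Omega -> S) : simple Pr Y ->
  exists C, [/\ almost_closed Pr Y C, Pr (eventually_in Y C) = 1 &
    splits Pr Y C -> forall A, A `<=` C -> ~ atomic Pr Y A].
Proof.
rewrite /simple /beta; case: xgetP => [D _ [_ Dac _ Dna D1]|_]; last first.
  (* The default [set0] has 0 elements, so [beta] equal to 1 comes from an actual decomposition. *)
  by rewrite /counting asboolT// fset_set0 cardfs0 => -[] /esym/eqP;
    rewrite oner_eq0.
rewrite /counting; case: asboolP => // fD [] /eqP;
  rewrite pnatr_eq1 => /cardfs1P[C DC].
have {}DC : D = [set C].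
  by rewrite -(fset_setK fD) DC; apply/seteqP; split => x /=;
    rewrite inE => /eqP.
rewrite DC in Dac Dna D1; exists C; split; first exact: Dac.
  by rewrite esum_set1 in D1.
by move=> sC; have [|] := Dna C erefl; first by split => //; exact: Dac.
Qed.

Lemma simple_mstep m : (0 < m)%N -> simple Pr (mstep_chain X m) ->
  exists C, [/\ regular_ae m C, {ae Pr, forall w, ev m 0 C w} &
    splits Pr (mstep_chain X m) C ->
      forall A, A `<=` C -> ~ atomic Pr (mstep_chain X m) A].
Proof.
move=> m0 /simple_cases[C [/(almost_closedP _ m0)[rC _] C1 sC]].
exists C; split => //.
have mC := measurable_ev 0 C m0.
apply/(negligibleP _ (measurableC mC)).
apply: etrans (probability_setC _ mC) _.
rewrite (_ : ev m 0 C = eventually_in (mstep_chain X m) C) ?C1 ?subee//.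
by apply/seteqP; split => w /(eventually_in_mstep C w m0).
Qed.

(** A zero-one law: up to transient sets, the whole state space is one atom of [X]. *)
Definition trivial_tail : Prop :=
  forall B, regular_ae 1 B -> {ae Pr, forall w, ev 1 0 B w} \/ transient_ae 1 B.

(** [B] cuts [C] into two regular parts; if neither were transient they would split [C]. *)
Lemma atomic_trivial_tail C : regular_ae 1 C -> {ae Pr, forall w, ev 1 0 C w} ->
  ~ splits Pr (mstep_chain X 1) C -> trivial_tail.
Proof.
move=> rC C1 nsC B rB.
have [tB|ntB] := pselect (transient_ae 1 (B `&` C)).
  right; apply: filterS2 C1 tB => w Cw Bw; have := evI Cw Bw.
  by apply: evS => x [Cx nBC] Bx; apply: nBC.
have [tC|ntC] := pselect (transient_ae 1 (C `&` ~` B)).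
  left; apply: filterS2 C1 tC => w Cw Bw; have := evI Cw Bw.
  by apply: evS => x [Cx nBC]; apply: contrapT => nB; apply: nBC.
case: nsC; exists (B `&` C), (C `&` ~` B); split.
- exact: subIsetr.
- exact: subIsetl.
- by apply/seteqP; split => // x [[Bx _] [_ nB]]; exact: nB.
- by apply/almost_closedP => //; split => //; exact: regular_aeI.
- by apply/almost_closedP => //; split => //; apply: regular_aeI => //;
    exact: regular_aeC.
Qed.

(** If [C] had no atomic subset, the part of the hull of [A] in [C] would split into [B1] and [B2].
    Ending up in either forces X into [A] along some residue class, so [A] meets both in almost
    closed sets, against its atomicity. *)
Lemma atom_of_mstep_atom m A C : (0 < m)%N ->
  atomic Pr (mstep_chain X m) A -> regular_ae 1 C ->
  {ae Pr, forall w, ev 1 0 C w} ->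
  ~ (forall B, B `<=` C -> ~ atomic Pr (mstep_chain X 1) B).
Proof.
move=> m0 [/(almost_closedP _ m0)[rA ntA] nsA] rC C1 naC.
pose B := hull m A `&` C.
have rB : regular_ae 1 B by apply: regular_aeI => //; exact: regular_ae_hull.
have ntB : ~ transient_ae 1 B.
  move=> tB; apply/ntA/(transient_ae_hull m0 rA).
  apply: filterS2 C1 tB => w Cw Bw; have := evI Cw Bw.
  by apply: evS => x [Cx nBC] hx; apply: nBC.
have acB : almost_closed Pr (mstep_chain X 1) B by apply/almost_closedP.
have [B1 [B2 [B1B B2B B12 ac1 ac2]]] : splits Pr (mstep_chain X 1) B.
  apply: contrapT => nsB; apply: (naC B); first exact: subIsetr.
  by split.
have acI B' : B' `<=` B -> almost_closed Pr (mstep_chain X 1) B' ->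
    almost_closed Pr (mstep_chain X m) (A `&` B').
  move=> B'B /almost_closedP-/(_ isT)[rB' ntB']; apply/almost_closedP => //;
    split.
    by apply: regular_aeI => //; apply: regular_ae_dvd rB'.
  move=> tAB; apply: ntB'.
  have tABr := ae_foralln (transient_ae_all m0 tAB).
  apply: filterS3 (ev_hull_inv m0 rA) rB' tABr => w [hA _] [|//] B'w nAB.
  have /hA[r Ar] : ev 1 0 (hull m A) w by apply: evS B'w => x /B'B[].
  have := evI Ar (ev_of_1 m r B'w).
  by move=> /(ev_disjoint m0 (setICr _))-/(_ (nAB r)).
apply: nsA; exists (A `&` B1), (A `&` B2);
  split; [exact: subIsetl|exact: subIsetl| |exact: acI|exact: acI].
by rewrite setIACA B12 setI0.
Qed.

Lemma trivial_tail_hit m A : (0 < m)%N -> trivial_tail ->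
  regular_ae m A -> ~ transient_ae m A ->
  {ae Pr, forall w, exists r : 'I_m, ev m r A w}.
Proof.
move=> m0 triv rA ntA.
have [h1|/(transient_ae_hull m0 rA)//] := triv _ (regular_ae_hull m0 rA).
apply: filterS2 (ev_hull_inv m0 rA) h1 => w [hA _] /hA[r Ar].
by exists (Ordinal (ltn_pmod r m0)); apply: ev_mod Ar; rewrite /= modn_mod.
Qed.

(** * Counting the residue classes occupied by a set *)

Definition phases m A w : {set 'I_m} := [set r : 'I_m | `[< ev m r A w >]]%SET.

(** Without atoms, splitting could go on forever. Disjoint pieces occupy disjoint nonempty sets of
    residues, so each split adds a phase, and there are at most [n]. *)
Lemma trivial_tail_atom n C : (0 < n)%N -> trivial_tail ->
  almost_closed Pr (mstep_chain X n) C ->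
  exists2 A, A `<=` C & atomic Pr (mstep_chain X n) A.
Proof.
move=> n0 triv acC; apply: contrapT => noatom.
have phases_ge k A : A `<=` C -> almost_closed Pr (mstep_chain X n) A ->
    {ae Pr, forall w, (k <= #|phases n A w|)%N}.
  elim: k A => [|k IH] A AC acA; first exact: aeW.
  have [A1 [A2 [A1A A2A A12 ac1 ac2]]] : splits Pr (mstep_chain X n) A.
    by apply: contrapT => nsA; apply: noatom; exists A.
  have [r2 nt2] := (almost_closedP _ n0).1 ac2.
  have := IH A1 (subset_trans A1A AC) ac1.
  apply: filterS2 (trivial_tail_hit n0 triv r2 nt2) => w [r A2r] k1.
  have A1A' : phases n A1 w \subset phases n A w.
    apply/fintype.subsetP => s; rewrite !finset.in_set => /asboolP A1s.
    by apply/asboolP; exact: evS A1s.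
  apply: leq_ltn_trans k1 _; apply: proper_card; apply/properP; split => //.
  exists r; rewrite finset.in_set; apply/asboolP; first exact: evS A2r.
  by move=> A1r; exact: ev_disjoint A12 A1r A2r.
have [w] := ae_ex (phases_ge n.+1 C (fun=> id) acC).
by rewrite ltnNge (leq_trans (max_card _))// card_ord.
Qed.

(** Each of the [m] disjoint sets occupies at least one of the [m] residues, and no two share one.
    The choice [f] of a residue is thus a bijection, and a second residue of [A] would belong to
    another set. *)
Lemma phase_unique m (D : set (set S)) : (0 < m)%N -> trivial_tail ->
  trivIset D id -> (forall C, D C -> almost_closed Pr (mstep_chain X m) C) ->
  counting D = m%:R%:E :> \bar R ->
  forall A, D A ->
  {ae Pr, forall w r s, ev m r A w -> ev m s A w -> r = s %[mod m]}.
Proof.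
move=> m0 triv tD Dac; rewrite /counting; case: asboolP => // fD [] /eqP.
rewrite eqr_nat => /eqP cD A DA.
pose c (i : 'I_m) := nth set0 (fset_set D) i.
have cin i : D (c i).
  have /(mem_nth set0) : (i < size (fset_set D))%N by rewrite cD.
  by rewrite in_fset_set// inE.
have cinj i j : c i = c j -> i = j.
  by move=> /eqP; rewrite nth_uniq ?fset_uniq ?cD ?ltn_ord// => /eqP/val_inj.
have [i0 cA] : exists i, c i = A.
  have : A \in fset_set D by rewrite in_fset_set// inE.
  by move=> /(nthP set0)[k kD <-]; rewrite cD in kD; exists (Ordinal kD).
have hit i : {ae Pr, forall w, exists r : 'I_m, ev m r (c i) w}.
  by have [rc ntc] := (almost_closedP _ m0).1 (Dac _ (cin i));
    exact: trivial_tail_hit.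
apply: filterS (filter_forall _ hit) => w hw.
pose f i := projT1 (cid (hw i)).
have fE i : ev m (f i) (c i) w by rewrite /f; case: cid.
have same i j r : ev m r (c i) w -> ev m r (c j) w -> i = j.
  move=> ci cj; apply: cinj; apply: (tD _ _ (cin i) (cin j)).
  by have [x] := ev_meet m0 ci cj; exists x.
have finj : injective f.
  by move=> i j fij; apply: (same _ _ _ (fE i)); rewrite fij; exact: fE.
suff phaseE r : ev m r A w -> r = f i0 %[mod m].
  by move=> r s /phaseE -> /phaseE ->.
have [g _ fK] := injF_bij finj.
pose r' := Ordinal (ltn_pmod r m0) => Ar.
have Ar' : ev m (f (g r')) (c i0) w.
  by rewrite fK cA; apply: ev_mod Ar; rewrite /= modn_mod.
have <- := same _ _ _ (fE (g r')) Ar'.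
by rewrite fK /= modn_mod.
Qed.

(** If [E] is visited infinitely often at residue [r], so are returns to the same state after [a]
    steps. These put X in [A] at residue r + a infinitely often, hence eventually by regularity. *)
Lemma ev_return m A a (eps : R) (E : set S) : (0 < m)%N -> regular_ae m A ->
  (0 < eps)%R -> (forall i, E i -> eps%:E <= nstep P a i i) ->
  {ae Pr, forall w r, ev m r A w -> ev m r (~` E) w \/ ev m (r + a) A w}.
Proof.
move=> m0 rA eps0 Ea; apply: ae_foralln => r.
have EQ i : E i -> eps%:E <= \esum_(j in [set i]) nstep P a i j.
  by rewrite esum_set1; [exact: Ea|exact: nstep_ge0].
apply: filterS2 (regular_ae_all m0 rA) (ev_transition r m0 eps0 EQ).
move=> w rw stay Ar; case: (rw (r + a)%N) => [|nAr]; first by right.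
left; apply: stay; case: nAr => N _ NA.
apply: filterS2 Ar (nbhs_infty_ge N) => t tA Nt tr [_ /= tt].
apply: (NA (t + a)%N) => /=.
- exact: leq_trans (leq_addr _ _).
- by rewrite -modnDml tr modnDml.
- by rewrite tt; exact: tA.
Qed.

(** Otherwise a return after [n] steps would give [A] a second phase, so the states with return
    probability at least [delta] are left for good at residue 0. The finitely many others are left
    too, and [A] would be transient. *)
Lemma phase_dvd m n A (delta : R) : (1 < m)%N ->
  regular_ae m A -> ~ transient_ae m A ->
  {ae Pr, forall w r s, ev m r A w -> ev m s A w -> r = s %[mod m]} ->
  (0 < delta)%R -> finite_set [set i : S | ~ (delta%:E <= nstep P n i i)] ->
  (m %| n)%N.
Proof.
move=> m1 rA ntA uniqA delta0 fF; have m0 := ltnW m1.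
apply: contrapT => mn.
have leave a (eps : R) (E : set S) : ~ (m %| a)%N -> (0 < eps)%R ->
    (forall i, E i -> eps%:E <= nstep P a i i) ->
    {ae Pr, forall w, ev m 0 A w -> ev m 0 (~` E) w}.
  move=> ma eps0 Ea;
    apply: filterS2 uniqA (ev_return m0 rA eps0 Ea) => w uw ew Aw.
  case: (ew _ Aw) => // Aw'; case: ma; have := uw _ _ Aw' Aw.
  by rewrite add0n mod0n => /eqP.
have leave1 i : {ae Pr, forall w, ev m 0 A w -> ev m 0 (~` [set i]) w}.
  (* If [m] divided all return times of [i], it would divide the period 1. *)
  have [a Pa ma] : exists2 a, 0 < nstep P a i i & ~ (m %| a)%N.
    apply: contrapT => na; have [_ /(_ m)] := Paper i.
    rewrite dvdn1 => /(_ _)/eqP m1'; move: m1; rewrite m1'// => a [_ Pa].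
    by apply: contrapT => ma; apply: na; exists a.
  (* [nstep] takes values in the extended reals; for an infinite value any positive [eps] will
     do. *)
  have [eps eps0 epsP] : exists2 eps : R, (0 < eps)%R & eps%:E <= nstep P a i i.
    case: (nstep P a i i) Pa => [x| |]//; first by exists x.
    by exists 1%R; rewrite ?leey.
  by apply: leave ma eps0 _ => _ ->.
have /finite_seqP[l lE] := fF.
have leaveF : {ae Pr, forall w, forall k : 'I_(size l),
    ev m 0 A w -> ev m 0 (~` [set tnth (in_tuple l) k]) w}.
  by apply: filter_forall => k; exact: leave1.
apply: ntA.
have leaveD : {ae Pr, forall w, ev m 0 A w ->
    ev m 0 (~` [set i | delta%:E <= nstep P n i i]) w}.
  exact: leave mn delta0 _.
apply: filterS3 (regular_ae_all m0 rA) leaveD leaveF => w rw lD lF.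
case: (rw 0%N) => // Aw.
have lFk (k : 'I_(size l)) : \forall t \near \oo, t = 0 %[mod m] ->
    (~` [set tnth (in_tuple l) k]) (X t w) by exact: lF.
have evF : ev m 0 (~` [set i | ~ delta%:E <= nstep P n i i]) w.
  apply: filterS (filter_forall _ lFk) => t tl t0;
    rewrite lE /= => /(nthP (X t w))[k kl kE].
  by apply: (tl (Ordinal kl) t0); rewrite /= (tnth_nth (X t w)).
by have [x [nx /contrapT]] := ev_meet m0 (lD Aw) evF.
Qed.

End chain.

(** * Excluding beta(X^(m)) = m for m at least 2 *)

Theorem corollary6 (R : realType) (S : countType)
  (Sinf : infinite_set [set: S])
  (P : S -> S -> R)
  (Pstoch : stochastic P) (Pirr : irreducible P) (Paper : aperiodic P)
  (d : measure_display) (Omega : measurableType d) (Pr : probability Omega R)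
  (X : nat -> Omega -> S) (Xchain : markov_chain Pr P X)
  (Xsimple : simple Pr X)
  (n : nat) (n_gt0 : (0 < n)%N)
  (delta : R) (delta_gt0 : (0 < delta)%R)
  (Pdiag : finite_set [set i : S | ~ (delta%:E <= nstep P n i i)])
  (Xnsimple : simple Pr (mstep_chain X n)) :
  asymptotically_aperiodic Pr X.
Proof.
(* The value m = 1 is attained because [X] is simple, so excluding larger [m] leaves a supremum of
   1. *)
suff no_period m : (1 < m)%N -> beta Pr (mstep_chain X m) <> m%:R%:E.
  rewrite /asymptotically_aperiodic /asymptotic_period.
  rewrite (_ : [set m%:R%:E | m in _] = [set 1]) ?ereal_sup1//.
  apply/seteqP; split => [_ [m [m0 mb] <-]|_ ->].
    by case: m m0 mb => [//|[//|m]] _ /no_period; case.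
  by exists 1%N => //; split => //; rewrite mstep_chain1.
move=> m1; have m0 := ltnW m1; rewrite /beta.
case: xgetP => [D _ [[_ tD] Dac Dna _ _]|_]; last first.
  rewrite /counting asboolT// fset_set0 cardfs0 => -[] /esym/eqP.
  by rewrite pnatr_eq0; case: m m1 m0.
move=> cD; have [A [B [DA DB AB]]] := counting_gt1 m1 cD.
(* At most one member of the decomposition is not atomic, so one of two distinct members is. *)
have [A' DA' atA'] : exists2 A', D A' & atomic Pr (mstep_chain X m) A'.
  have [aA|naA] := pselect (atomic Pr (mstep_chain X m) A); first by exists A.
  have [aB|naB] := pselect (atomic Pr (mstep_chain X m) B); first by exists B.
  by case: AB; exact: Dna.
have [C [rC C1 sC]] : exists C,
    [/\ regular_ae Pr X 1 C, {ae Pr, forall w, ev X 1 0 C w} &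
    splits Pr (mstep_chain X 1) C ->
      forall A, A `<=` C -> ~ atomic Pr (mstep_chain X 1) A].
  by apply: (simple_mstep Xchain) => //; rewrite mstep_chain1.
have triv : trivial_tail Pr X.
  apply: (atomic_trivial_tail Xchain rC C1) => /sC.
  exact: (atom_of_mstep_atom Pstoch Xchain Paper m0 atA' rC C1).
have acD E : D E -> regular_ae Pr X m E /\ ~ transient_ae Pr X m E.
  by move=> /Dac/(almost_closedP Xchain _ m0).
have mn : (m %| n)%N.
  have [rA ntA] := acD A DA.
  apply: (phase_dvd Pstoch Xchain Paper m1 rA ntA _ delta_gt0 Pdiag).
  exact: (phase_unique Pstoch Xchain Paper m0 triv tD Dac cD).
have [C' [rC' C'1 sC']] := simple_mstep Xchain n_gt0 Xnsimple.
have ntC' : ~ transient_ae Pr X n C'.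
  move=> tC'; have [w] := ae_ex (filterI C'1 tC').
  by move=> [Cw]; exact: ev_disjoint (setICr _) Cw.
have [E EC' aE] := trivial_tail_atom Pstoch Xchain Paper n_gt0 triv
  ((almost_closedP Xchain _ n_gt0).2 (conj rC' ntC')).
(* [E] is an atom inside [C'], which is impossible once [C'] splits; [A] and [B] provide the
   splitting. *)
apply: sC' EC' aE.
(* As [m] divides [n], ending up in [E'] at multiples of [m] entails the same at multiples of [n],
   so [E'] keeps its regularity and its non-transience inside [C']. *)
have acC' E' : D E' -> almost_closed Pr (mstep_chain X n) (E' `&` C').
  move=> /acD[rE' ntE']; apply/(almost_closedP Xchain _ n_gt0); split.
    by apply: regular_aeI => //; exact: regular_ae_dvd rE'.
  move=> tE'; apply: ntE'.
  have rE'all := regular_ae_all Pstoch Xchain Paper m0 rE'.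
  apply: filterS3 C'1 tE' rE'all => w Cw nw rw.
  case: (rw 0%N) => // /(ev_dvd mn) Ew.
  by have := ev_disjoint n_gt0 (setICr _) (evI Ew Cw) nw.
exists (A `&` C'), (B `&` C');
  split; [exact: subIsetr|exact: subIsetr| |exact: acC'|exact: acC'].
rewrite setIACA (_ : A `&` B = set0) ?set0I//.
apply: contrapT => /eqP/set0P AB0; apply: AB; exact: (tD _ _ DA DB).
Qed.
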